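(* Let $R$ be a ring, $G$ a finite group acting on $R$, $H$ a subgroup of $G$, $n\ge 0$ an integer, $M$ an $RH$-module and $N$ an $RG$-module. Then: (1) $(n,0)\text{-id}_{RH}(M)=(n,0)\text{-id}_{RG}(M\uparrow_H^G)$. (2) $(n,0)\text{-id}_{RG}(N)\ge (n,0)\text{-id}_{RH}(N\downarrow_H^G)$, and equality holds when $RG$ is a separable extension over $RH$. (3) $(n,0)\text{-fd}_{RH}(M)=(n,0)\text{-fd}_{RG}(M\uparrow_H^G)$. (4) $(n,0)\text{-fd}_{RG}(N)\ge (n,0)\text{-fd}_{RH}(N\downarrow_H^G)$, and equality holds when $RG$ is a separable extension over $RH$. (5) $\mathrm{nCd}_{RH}(M)=\mathrm{nCd}_{RG}(M\uparrow_H^G)$. (6) $\mathrm{nCd}_{RG}(N)\ge \mathrm{nCd}_{RH}(N\downarrow_H^G)$, and equality holds when $RG$ is a separable extension over $RH$.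
   Context: Rings are associative with identity; modules are unitary and are left modules unless otherwise specified. $G$ acts on $R$ by ring automorphisms: $r\mapsto g(r)$ is a ring automorphism for each $g\in G$, $(g_1g_2)(r)=g_1(g_2(r))$ and $1(r)=r$. The skew group ring $RG$ is the free left $R$-module with basis $G$ and multiplication $(ag)(bh)=a\,g(b)\,gh$ for $a,b\in R$, $g,h\in G$. For a subgroup $H\le G$ (with the restricted action), $RH$ is a subring of $RG$. For an $RH$-module $M$, $M\uparrow_H^G=RG\otimes_{RH}M$ is the induced $RG$-module; for an $RG$-module $N$, $N\downarrow_H^G$ is $N$ viewed as an $RH$-module by restriction of scalars. A ring $A$ is a separable extension over a subring $S$ if the multiplication map $A\otimes_S A\to A$, $a\otimes b\mapsto ab$, splits as a map of $A$-$A$-bimodules; i.e. there is $\sum_i a_i\otimes b_i\in A\otimes_S A$ with $\sum_i a_i\otimes b_i a=\sum_i a a_i\otimes b_i$ for all $a\in A$ and $\sum_i a_ib_i=1$. An $A$-module $F$ is finitely $n$-presented if there is an exact sequence $F_n\to\cdots\to F_0\to F\to 0$ with all $F_i$ finitely generated projective. An $A$-module $F$ is $(n,0)$-flat if $\operatorname{Tor}_1^A(X,F)=0$ for all finitely $n$-presented right $A$-modules $X$. For an $A$-module $M$, each of the following is the smallest integer $k\ge0$ with the stated property ($\infty$ if no such $k$ exists): $(n,0)\text{-id}_A(M)$: $\operatorname{Ext}^{k+1}_A(F,M)=0$ for every finitely $n$-presented $A$-module $F$; $(n,0)\text{-fd}_A(M)$: $\operatorname{Tor}_{k+1}^A(F,M)=0$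 for every finitely $n$-presented right $A$-module $F$; $\mathrm{nCd}_A(M)$: $\operatorname{Ext}^{k+1}_A(F,M)=0$ for every $(n,0)$-flat $A$-module $F$. *)

(* Defs.v *)
From HB Require Import structures.
From mathcomp Require Import all_boot all_order all_algebra all_fingroup.
From mathcomp Require Import generic_quotient boolp.

Set Implicit Arguments.
Unset Strict Implicit.
Unset Printing Implicit Defensive.

Import GRing.Theory.
Local Open Scope ring_scope.
Local Open Scope quotient_scope.

(* Rings are pzRingType's (the zero ring is allowed), left A-modules are      *)
(* lmodType A's, and right A-modules are left modules over the converse ring  *)
(* A^c: for X : lmodType A^c, the right action x.a is written a *: x.         *)

Record ring_action (R : pzRingType) (gT : finGroupType) := RingAction {
  ract :> gT -> {rmorphism R -> R};
  ract1 : forall r, ract 1%g r = r;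
  ractM : forall g h r, ract (g * h)%g r = ract g (ract h r)
}.

(* The element u stands for the formal sum of the (u g) g, g in gT; the       *)
(* product is the biadditive extension of (a g)(b h) = a g(b) gh.             *)
Definition skew_group_ring (R : pzRingType) (gT : finGroupType)
  (act : ring_action R gT) : Type := {ffun gT -> R}.

Section SkewGroupRing.
Variables (R : pzRingType) (gT : finGroupType) (act : ring_action R gT).
Local Notation RG := (skew_group_ring act).

HB.instance Definition _ := GRing.Zmodule.on RG.

Definition skew_one : RG := [ffun g => if g == 1%g then 1 else 0].

Definition skew_mul (u v : RG) : RG :=
  [ffun k => \sum_(g : gT) u g * act g (v (g^-1 * k)%g)].

Lemma skew_mulA : associative skew_mul.
Proof.
move=> u v w; apply/ffunP=> k; rewrite !ffunE.
under eq_bigr => g _.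
  rewrite ffunE raddf_sum mulr_sumr.
  rewrite (reindex_inj (mulgI g^-1%g)) /=.
  over.
rewrite exchange_big /=; apply: eq_bigr => h _.
rewrite ffunE mulr_suml; apply: eq_bigr => g _.
rewrite rmorphM -ractM mulKVg mulrA; congr (_ * _ * act _ (w _)).
by rewrite invMg invgK -!mulgA mulKVg.
Qed.

Lemma skew_mul1l : left_id skew_one skew_mul.
Proof.
move=> u; apply/ffunP=> k; rewrite ffunE (bigD1 1%g) //= ffunE eqxx mul1r.
rewrite ract1 invg1 mul1g big1 ?addr0 // => g /negbTE g1.
by rewrite ffunE g1 mul0r.
Qed.

Lemma skew_mulr1 : right_id skew_one skew_mul.
Proof.
move=> u; apply/ffunP=> k; rewrite ffunE (bigD1 k) //= ffunE mulVg eqxx.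
rewrite rmorph1 mulr1 big1 ?addr0 // => g /negbTE gk.
by rewrite ffunE -eq_mulVg1 gk rmorph0 mulr0.
Qed.

Lemma skew_mulDl : left_distributive skew_mul +%R.
Proof.
move=> u v w; apply/ffunP=> k; rewrite !ffunE -big_split /=.
by apply: eq_bigr => g _; rewrite ffunE mulrDl.
Qed.

Lemma skew_mulDr : right_distributive skew_mul +%R.
Proof.
move=> u v w; apply/ffunP=> k; rewrite !ffunE -big_split /=.
by apply: eq_bigr => g _; rewrite ffunE raddfD mulrDr.
Qed.

HB.instance Definition _ := GRing.Zmodule_isPzRing.Build RG
  skew_mulA skew_mul1l skew_mulr1 skew_mulDl skew_mulDr.

End SkewGroupRing.

Section SkewSubring.
Variables (R : pzRingType) (gT : finGroupType) (act : ring_action R gT).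
Variable H : {group gT}.

Definition restr_action : ring_action R (subg_of H) :=
  @RingAction R (subg_of H) (fun h => act (sgval h))
    (ract1 act) (fun g h => ractM act (sgval g) (sgval h)).

Definition skew_incl (u : skew_group_ring restr_action) : skew_group_ring act :=
  [ffun g => if g \in H then u (subg H g) else 0].

Lemma skew_incl_is_zmod_morphism : zmod_morphism skew_incl.
Proof.
by move=> u v; apply/ffunP=> g; rewrite !ffunE; case: ifP; rewrite ?subr0.
Qed.

Lemma skew_incl_is_monoid_morphism : monoid_morphism skew_incl.
Proof.
split=> [|u v]; apply/ffunP=> k; rewrite !ffunE.
  case: ifP => [kH|kNH]; last by case: eqP kNH => // ->; rewrite group1.
  by rewrite -(inj_eq subg_inj) subgK //=.
rewrite [RHS](bigID [in H]) /= [X in _ = _ + X]big1 ?addr0; last first.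
  by move=> g /negbTE gNH; rewrite ffunE gNH mul0r.
case: ifP => [kH|kNH]; last first.
  rewrite big1 // => g gH.
  by rewrite [skew_incl v _]ffunE groupMl ?groupV // kNH rmorph0 mulr0.
rewrite [RHS](reindex (@sgval _ H)) /=; last first.
  by exists (subg H) => [h _|g gH]; rewrite ?sgvalK ?subgK.
apply: eq_big => [h|h _]; first by rewrite subgP.
rewrite !ffunE subgP sgvalK groupMl ?groupV ?subgP // kH.
by congr (_ * act _ (v _)); apply: subg_inj; rewrite /= !subgK // groupM ?groupV ?subgP.
Qed.

HB.instance Definition _ := GRing.isZmodMorphism.Build
  (skew_group_ring restr_action) (skew_group_ring act) skew_incl
  skew_incl_is_zmod_morphism.
HB.instance Definition _ := GRing.isMonoidMorphism.Build
  (skew_group_ring restr_action) (skew_group_ring act) skew_incl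
  skew_incl_is_monoid_morphism.

End SkewSubring.

Section Tensor.
Variables (A : pzRingType) (X : lmodType A^c) (F : lmodType A).
Implicit Types (x y : X) (m : F) (s t : seq (X * F)).

(* A list [:: (x1, m1); ...; (xr, mr)] stands for the sum of the              *)
(* xi (x) mi; no formal opposites are needed, since - (x (x) m) is            *)
(* (- x) (x) m.                                                               *)
Inductive tens_rel : seq (X * F) -> seq (X * F) -> Prop :=
| TensRefl s : tens_rel s s
| TensSym s t : tens_rel s t -> tens_rel t s
| TensTrans s t u : tens_rel s t -> tens_rel t u -> tens_rel s u
| TensCat s s' t t' :
    tens_rel s s' -> tens_rel t t' -> tens_rel (s ++ t) (s' ++ t')
| TensComm s t : tens_rel (s ++ t) (t ++ s)
| Tens0 m : tens_rel [:: (0, m)] [::]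
| TensDl x y m : tens_rel [:: (x + y, m)] [:: (x, m); (y, m)]
| TensDr x m m' : tens_rel [:: (x, m + m')] [:: (x, m); (x, m')]
| TensBal (a : A) x m : tens_rel [:: ((a : A^c) *: x, m)] [:: (x, a *: m)].

Definition tens_relb : rel (seq (X * F)) := fun s t => `[< tens_rel s t >].

Lemma tens_relb_refl : reflexive tens_relb.
Proof. by move=> s; apply/asboolP; apply: TensRefl. Qed.

Lemma tens_relb_sym : symmetric tens_relb.
Proof. by move=> s t; apply/asboolP/asboolP; apply: TensSym. Qed.

Lemma tens_relb_trans : transitive tens_relb.
Proof.
by move=> t s u /asboolP st /asboolP tu; apply/asboolP; apply: TensTrans tu.
Qed.

Canonical tens_equiv :=
  EquivRel tens_relb tens_relb_refl tens_relb_sym tens_relb_trans.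

Definition tens : Type := {eq_quot tens_equiv}.
HB.instance Definition _ := Choice.on tens.
HB.instance Definition _ := EqQuotient.on tens.

Definition tens_class (s : seq (X * F)) : tens := \pi_tens s.

Lemma tens_classP s t : tens_class s = tens_class t <-> tens_rel s t.
Proof.
split=> [/eqP|st]; first by rewrite eqmodE => /asboolP.
by apply/eqP; rewrite eqmodE; apply/asboolP.
Qed.

Lemma tens_reprK (z : tens) : tens_class (repr z) = z.
Proof. exact: reprK. Qed.

Definition tens_zero : tens := tens_class [::].
Definition tens_add (z w : tens) : tens := tens_class (repr z ++ repr w).
Definition tens_opp (z : tens) : tens :=
  tens_class [seq (- p.1, p.2) | p <- repr z].

Lemma tens_add_class s t :
  tens_add (tens_class s) (tens_class t) = tens_class (s ++ t).
Proof.
by apply/tens_classP/TensCat; apply/tens_classP; rewrite tens_reprK.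
Qed.

Lemma tens_addA : associative tens_add.
Proof.
move=> z w v; rewrite -[z]tens_reprK -[w]tens_reprK -[v]tens_reprK.
by rewrite !tens_add_class catA.
Qed.

Lemma tens_addC : commutative tens_add.
Proof. by move=> z w; apply/tens_classP; apply: TensComm. Qed.

Lemma tens_add0 : left_id tens_zero tens_add.
Proof. by move=> z; rewrite -[z]tens_reprK tens_add_class. Qed.

Lemma tens_rel_move s p t : tens_rel (s ++ p :: t) (p :: s ++ t).
Proof.
rewrite -[p :: t]cat1s -[p :: s ++ t]cat1s !catA.
by apply: TensCat (TensRefl _); apply: TensComm.
Qed.

Lemma tens_rel_cons p s t : tens_rel s t -> tens_rel (p :: s) (p :: t).
Proof. exact: (@TensCat [:: p] [:: p] _ _ (TensRefl _)). Qed.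

Lemma tens_addN : left_inverse tens_zero tens_opp tens_add.
Proof.
move=> z; rewrite -{2}[z]tens_reprK tens_add_class; apply/tens_classP.
elim: (repr z) => [|[x m] s IHs] /=; first exact: TensRefl.
apply: TensTrans (tens_rel_cons _ (tens_rel_move _ _ _)) _.
apply: (@TensCat [:: (- x, m); (x, m)] [::] _ [::]) IHs.
apply: TensTrans (Tens0 m); rewrite -(addNr x).
exact: TensSym (TensDl _ _ _).
Qed.

HB.instance Definition _ := GRing.isZmodule.Build tens
  tens_addA tens_addC tens_add0 tens_addN.

Lemma tens_classD s t : tens_class (s ++ t) = tens_class s + tens_class t.
Proof. by rewrite -tens_add_class. Qed.

End Tensor.

Section TensorMap.
Variables (A : pzRingType) (X Y : lmodType A^c) (F : lmodType A).

(* f (x) id_F *)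
Definition tens_map (f : {linear X -> Y}) (z : tens X F) : tens Y F :=
  tens_class [seq (f p.1, p.2) | p <- repr z].

Lemma tens_map_class (f : {linear X -> Y}) (s : seq (X * F)) :
  tens_map f (tens_class s) = tens_class [seq (f p.1, p.2) | p <- s].
Proof.
apply/tens_classP.
have : tens_rel (repr (tens_class s)) s by apply/tens_classP/tens_reprK.
move: (repr _) => r; elim: r s / => [s|s t _|s t u _ + _|s s' t t' _ + _|s t|m|x y m|x m m'|a x m] /=.
- exact: TensRefl.
- exact: TensSym.
- exact: TensTrans.
- by rewrite !map_cat; apply: TensCat.
- by rewrite !map_cat; apply: TensComm.
- by rewrite raddf0; apply: Tens0.
- by rewrite raddfD; apply: TensDl.
- exact: TensDr.
- by rewrite linearZ; apply: TensBal.
Qed.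

Lemma tens_mapD (f : {linear X -> Y}) (z w : tens X F) :
  tens_map f (z + w) = tens_map f z + tens_map f w.
Proof.
rewrite -[z]tens_reprK -[w]tens_reprK -tens_classD !tens_map_class map_cat.
by rewrite tens_classD.
Qed.

End TensorMap.

Definition restr (S A : pzRingType) (f : {rmorphism S -> A})
  (M : lmodType A) : Type := M.

Section Scalars.
Variables (S A : pzRingType) (f : {rmorphism S -> A}).

HB.instance Definition _ (M : lmodType A) := GRing.Zmodule.on (restr f M).

Section Restr.
Variable M : lmodType A.

Definition restr_scale (s : S) (m : restr f M) : restr f M := f s *: (m : M).

Lemma restr_scaleA a b m :
  restr_scale a (restr_scale b m) = restr_scale (a * b) m.
Proof. by rewrite /restr_scale scalerA rmorphM. Qed.

Lemma restr_scale1 : left_id 1 restr_scale.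
Proof. by move=> m; rewrite /restr_scale rmorph1 scale1r. Qed.

Lemma restr_scaleDr : right_distributive restr_scale +%R.
Proof. by move=> a m m'; apply: scalerDr. Qed.

Lemma restr_scaleDl m : {morph restr_scale^~ m : a b / a + b}.
Proof. by move=> a b; rewrite /restr_scale rmorphD scalerDl. Qed.

HB.instance Definition _ := GRing.Zmodule_isLmodule.Build S (restr f M)
  restr_scaleA restr_scale1 restr_scaleDr restr_scaleDl.
End Restr.

(* The same ring morphism between the converse rings, so that right modules   *)
(* can be restricted as well.                                                 *)
Definition conv_mor (s : S^c) : A^c := f s.

Lemma conv_mor_is_zmod_morphism : zmod_morphism conv_mor.
Proof. exact: (rmorphB f). Qed.

Lemma conv_mor_is_monoid_morphism : monoid_morphism conv_mor.
Proof. by split=> [|a b]; [apply: (rmorph1 f) | apply: (rmorphM f)]. Qed.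

HB.instance Definition _ := GRing.isZmodMorphism.Build S^c A^c conv_mor
  conv_mor_is_zmod_morphism.
HB.instance Definition _ := GRing.isMonoidMorphism.Build S^c A^c conv_mor
  conv_mor_is_monoid_morphism.

Definition conv_rmor : {rmorphism S^c -> A^c} := conv_mor.

End Scalars.

Section Induction.
Variables (S A : pzRingType) (f : {rmorphism S -> A}).

(* A as a right S-module. *)
Definition ring_right : lmodType S^c := restr (conv_rmor f) (A^c)^o.

Definition lmulmap (a : A) (x : ring_right) : ring_right := a * (x : A).

Lemma lmulmap_is_linear a : linear (lmulmap a).
Proof.
move=> s x y; rewrite /lmulmap.
rewrite -[LHS]/(a * ((x : A) * f s + (y : A)) : A).
by rewrite mulrDr mulrA.
Qed.

HB.instance Definition _ a := GRing.isLinear.Build S^c ring_right ring_right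
  _ (lmulmap a) (lmulmap_is_linear a).

Definition ind (M : lmodType S) : Type := tens ring_right M.
HB.instance Definition _ (M : lmodType S) := GRing.Zmodule.on (ind M).

Section IndModule.
Variable M : lmodType S.

Definition ind_scale (a : A) (z : ind M) : ind M := tens_map (lmulmap a) z.

Lemma ind_scaleA a b z : ind_scale a (ind_scale b z) = ind_scale (a * b) z.
Proof.
rewrite /ind_scale -[z]tens_reprK !tens_map_class -map_comp.
by congr tens_class; apply: eq_map => p /=; rewrite /lmulmap mulrA.
Qed.

Lemma ind_scale1 : left_id 1 ind_scale.
Proof.
move=> z; rewrite /ind_scale -[z]tens_reprK tens_map_class; congr tens_class.
by rewrite -[RHS]map_id; apply: eq_map => -[x m] /=; rewrite /lmulmap mul1r.
Qed.

Lemma ind_scaleDr : right_distributive ind_scale +%R.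
Proof. by move=> a z w; apply: tens_mapD. Qed.

Lemma ind_scaleDl z : {morph ind_scale^~ z : a b / a + b}.
Proof.
move=> a b; rewrite /ind_scale -[z]tens_reprK !tens_map_class -tens_classD.
apply/tens_classP; elim: (repr z) => [|[x m] s IHs] /=; first exact: TensRefl.
rewrite {1}/lmulmap mulrDl.
apply: TensTrans (TensCat (TensDl _ _ _) IHs) _ => /=.
by apply/tens_rel_cons/TensSym/tens_rel_move.
Qed.

HB.instance Definition _ := GRing.Zmodule_isLmodule.Build A (ind M)
  ind_scaleA ind_scale1 ind_scaleDr ind_scaleDl.
End IndModule.

(* A is a separable extension of S: some Sum a_i (x) b_i in A (x)_S A         *)
(* satisfies Sum a_i (x) b_i a = Sum a a_i (x) b_i for all a, and             *)
(* Sum a_i b_i = 1.                                                           *)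
Definition separable_extension : Prop :=
  exists s : seq (A * A),
    (forall a : A,
       @tens_class S ring_right (restr f A^o) [seq (p.1, p.2 * a) | p <- s] =
       @tens_class S ring_right (restr f A^o) [seq (a * p.1, p.2) | p <- s]) /\
    \sum_(p <- s) p.1 * p.2 = 1.

End Induction.

Section Homological.
Variable A : pzRingType.

Definition projective (P : lmodType A) : Prop :=
  forall (U V : lmodType A) (p : {linear U -> V}) (g : {linear P -> V}),
    (forall v, exists u, p u = v) ->
    exists h : {linear P -> U}, forall x, p (h x) = g x.

Definition fingen (P : lmodType A) : Prop :=
  exists (r : nat) (e : 'I_r -> P),
    forall x, exists c : 'I_r -> A, x = \sum_(i < r) c i *: e i.

(* ... -> F_2 -> F_1 -> F_0 -> F *)
Record augmented_seq (F : lmodType A) := AugmentedSeq {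
  term :> nat -> lmodType A;
  diff : forall i, {linear term i.+1 -> term i};
  aug : {linear term 0%N -> F}
}.

Definition exact_at (U V W : lmodType A) (f : U -> V) (g : V -> W) : Prop :=
  forall y, g y = 0 <-> exists x, f x = y.

Definition proj_resolution (F : lmodType A) (P : augmented_seq F) : Prop :=
  [/\ forall i, projective (P i),
      forall y, exists x, aug P x = y,
      exact_at (diff P 0%N) (aug P) &
      forall i, exact_at (diff P i.+1) (diff P i)].

(* Only the part F_n -> ... -> F_0 -> F of the sequence is constrained.       *)
Definition fin_presented (n : nat) (F : lmodType A) : Prop :=
  exists P : augmented_seq F,
    [/\ forall i, (i <= n)%N -> fingen (P i) /\ projective (P i),
        forall y, exists x, aug P x = y,
        (0 < n)%N -> exact_at (diff P 0%N) (aug P) &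
        forall i, (i.+1 < n)%N -> exact_at (diff P i.+1) (diff P i)].

Definition cocycle (F M : lmodType A) (P : augmented_seq F) (i : nat)
    (c : {linear P i -> M}) : Prop :=
  forall x, c (diff P i x) = 0.

Definition coboundary (F M : lmodType A) (P : augmented_seq F) (i : nat) :
    {linear P i -> M} -> Prop :=
  match i with
  | 0 => fun c => forall x, c x = 0
  | j.+1 => fun c => exists b : {linear P j -> M}, forall x, c x = b (diff P j x)
  end.

(* Ext^i_A(F, M) = 0: the complex Hom_A(P, M) has no cohomology in degree i,  *)
(* for P any projective resolution of F.                                      *)
Definition Ext_eq0 (i : nat) (F M : lmodType A) : Prop :=
  forall P : augmented_seq F, proj_resolution P ->
    forall c : {linear P i -> M}, cocycle c -> coboundary c.

End Homological.

Definition cycle (A : pzRingType) (X : lmodType A^c) (F : lmodType A)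
    (P : augmented_seq X) (i : nat) : tens (P i) F -> Prop :=
  match i with
  | 0 => fun=> True
  | j.+1 => fun z => tens_map (diff P j) z = 0
  end.

Definition boundary (A : pzRingType) (X : lmodType A^c) (F : lmodType A)
    (P : augmented_seq X) (i : nat) (z : tens (P i) F) : Prop :=
  exists w : tens (P i.+1) F, tens_map (diff P i) w = z.

(* Tor_i^A(X, F) = 0: the complex P (x)_A F has no homology in degree i, for  *)
(* P any projective resolution of the right module X.                         *)
Definition Tor_eq0 (A : pzRingType) (i : nat)
    (X : lmodType A^c) (F : lmodType A) : Prop :=
  forall P : augmented_seq X, proj_resolution P ->
    forall z : tens (P i) F, cycle z -> boundary z.

Section Dimensions.
Variables (A : pzRingType) (n : nat).

Definition n0_flat (F : lmodType A) : Prop :=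
  forall X : lmodType A^c, fin_presented n X -> Tor_eq0 1 X F.

(* The elements of N u {oo}; None is oo. *)
Definition edim := option nat.

Definition smallest (P : nat -> Prop) : edim :=
  match pselect (exists k, `[< P k >]) with
  | left exP => Some (ex_minn exP)
  | right _ => None
  end.

Definition n0_id (M : lmodType A) : edim :=
  smallest (fun k =>
    forall F : lmodType A, fin_presented n F -> Ext_eq0 k.+1 F M).

Definition n0_fd (M : lmodType A) : edim :=
  smallest (fun k =>
    forall F : lmodType A^c, fin_presented n F -> Tor_eq0 k.+1 F M).

Definition nCd (M : lmodType A) : edim :=
  smallest (fun k =>
    forall F : lmodType A, n0_flat F -> Ext_eq0 k.+1 F M).

End Dimensions.

Definition edim_le (d e : edim) : bool :=
  match d, e with
  | _, None => true
  | None, Some _ => false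
  | Some k, Some l => (k <= l)%N
  end.

Section GroupModules.
Variables (R : pzRingType) (gT : finGroupType) (act : ring_action R gT).
Variable H : {group gT}.
Local Notation RG := (skew_group_ring act).
Local Notation RH := (skew_group_ring (restr_action act H)).

Definition skew_inclusion : {rmorphism RH -> RG} := @skew_incl R gT act H.

Definition induced (M : lmodType RH) : lmodType RG := ind skew_inclusion M.

Definition restricted (N : lmodType RG) : lmodType RH :=
  restr skew_inclusion N.

End GroupModules.

(* Main.v *)
(* The inclusion RH -> RG is a split Frobenius extension: restriction of      *)
(* coefficients to H is an RH-bimodule retraction E : RG -> RH, and the       *)
(* representatives t of the left cosets of H, with their inverses, are dual   *)
(* bases for E. For any split Frobenius extension S -> A, induction and       *)
(* restriction are adjoint to each other on both sides, so they are exact and *)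
(* preserve projectives, finitely n-presented modules and, since Tor is       *)
(* compared in the same way, (n,0)-flat modules. Write ^ for induction and |  *)
(* for restriction. A projective resolution of F over S induces one of F^     *)
(* over A and a resolution of F over A restricts to one over S; adjunction    *)
(* then compares Ext_A(F^, N) with Ext_S(F, N|) and Ext_A(F, M^) with         *)
(* Ext_S(F|, M), and likewise for Tor. The reverse implications hold because  *)
(* M is a direct summand of M^| (by E) and, when A is separable over S, N is  *)
(* naturally a direct summand of N|^ (averaging by the separability element). *)
(* As each comparison only has to transport vanishing, split injections of    *)
(* complexes replace isomorphisms throughout. The converse of a Frobenius     *)
(* extension is again Frobenius, which provides the statements on right       *)
(* modules.                                                                   *)

From HB Require Import structures.
Require Import Defs.
From mathcomp Require Import all_boot all_order all_algebra all_fingroup.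
From mathcomp Require Import generic_quotient boolp.

Set Implicit Arguments.
Unset Strict Implicit.
Unset Printing Implicit Defensive.

Import GRing.Theory.
Local Open Scope ring_scope.

(** * Tensor products *)

(** Each dimension is the least k at which Ext or Tor in degree k+1 vanishes on a class of test
    modules, and each such class is stable under induction and restriction. So it suffices to move
    vanishing between S and A for a split Frobenius extension, the record [frobenius], which
    [skew_frobenius] provides for RH -> RG. Vanishing passes from N to N| by [Ext_restr] and
    [Tor_restr], from M to M^ by [Ext_ind] and [Tor_ind], from M^| to its summand M by [Ext_retract]
    and [Tor_retract], and, in the separable case, from N| to N by [Ext_separable] and
    [Tor_separable]. For [nCd] the test class is itself cut out by Tor, so its stability
    ([ind_n0_flat], [restr_n0_flat]) comes from the Tor comparisons. *)

Definition linear_of (A : pzRingType) (U V : lmodType A) (g : U -> V)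
    (lin_g : linear g) : {linear U -> V} :=
  HB.pack g (GRing.isLinear.Build A U V *:%R g lin_g).

Section TensorTheory.
Variables (A : pzRingType) (X : lmodType A^c) (F : lmodType A).

Definition tmul (x : X) (m : F) : tens X F := tens_class [:: (x, m)].

Lemma tmulDl x y m : tmul (x + y) m = tmul x m + tmul y m.
Proof. by rewrite /tmul -tens_classD; apply/tens_classP/TensDl. Qed.

Lemma tmulDr x m m' : tmul x (m + m') = tmul x m + tmul x m'.
Proof. by rewrite /tmul -tens_classD; apply/tens_classP/TensDr. Qed.

Lemma tmulZ (a : A) x m : tmul ((a : A^c) *: x) m = tmul x (a *: m).
Proof. exact/tens_classP/TensBal. Qed.

Lemma tmul0l m : tmul 0 m = 0.
Proof. by apply: (addIr (tmul 0 m)); rewrite -tmulDl !add0r. Qed.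

Lemma tmul_suml (I : Type) (r : seq I) (x : I -> X) m :
  tmul (\sum_(i <- r) x i) m = \sum_(i <- r) tmul (x i) m.
Proof. by apply: (big_morph (tmul^~ m) _ (tmul0l m)) => y z; apply: tmulDl. Qed.

Lemma tmul0r x : tmul x 0 = 0.
Proof. by apply: (addIr (tmul x 0)); rewrite -tmulDr !add0r. Qed.

Lemma tmul_sumr (I : Type) (r : seq I) x (m : I -> F) :
  tmul x (\sum_(i <- r) m i) = \sum_(i <- r) tmul x (m i).
Proof. by apply: (big_morph (tmul x) _ (tmul0r x)) => y z; apply: tmulDr. Qed.

Lemma tens_classE s : tens_class s = \sum_(p <- s) tmul p.1 p.2.
Proof.
elim: s => [|[x m] s IHs]; first by rewrite big_nil.
by rewrite big_cons -cat1s tens_classD IHs.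
Qed.

Lemma tens_ind (P : tens X F -> Prop) :
  P 0 -> (forall x m, P (tmul x m)) ->
  (forall z w, P z -> P w -> P (z + w)) -> forall z, P z.
Proof.
move=> P0 Pm PD z; rewrite -[z]tens_reprK tens_classE.
by elim/big_ind: _ => // p _; apply: Pm.
Qed.

Lemma eq_tens (Z : zmodType) (u v : {additive tens X F -> Z}) :
  (forall x m, u (tmul x m) = v (tmul x m)) -> u =1 v.
Proof.
move=> uv z; elim/tens_ind: z => [|x m|z w Ez Ew]; rewrite ?raddf0 //.
by rewrite !raddfD Ez Ew.
Qed.

Section Lift.
Variables (Z : zmodType) (b : X -> F -> Z).

Definition balanced : Prop :=
  [/\ forall x y m, b (x + y) m = b x m + b y m,
      forall x m m', b x (m + m') = b x m + b x m' &
      forall (a : A) x m, b ((a : A^c) *: x) m = b x (a *: m)].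

Hypothesis bal_b : balanced.

Definition tens_lift_fun of balanced := fun z : tens X F =>
  \sum_(p <- repr z) b p.1 p.2.

(** Independence of the chosen representative: every generator of [tens_rel] preserves the sum. *)
Lemma tens_lift_class s :
  tens_lift_fun bal_b (tens_class s) = \sum_(p <- s) b p.1 p.2.
Proof.
have [bDl bDr bZ] := bal_b; rewrite /tens_lift_fun.
have : tens_rel (repr (tens_class s)) s by apply/tens_classP/tens_reprK.
move: (repr _) => r; elim: r s / =>
  [s|s t _|s t u _ -> _|s s' t t' _ + _|s t|m|x y m|x m m'|a x m] //=.
- by rewrite !big_cat /= => -> ->.
- by rewrite !big_cat /= addrC.
- rewrite big_seq1 big_nil; apply: (addIr (b 0 m)) => /=.
  by rewrite -bDl !add0r.
- by rewrite !big_cons !big_nil bDl !addr0.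
- by rewrite !big_cons !big_nil bDr !addr0.
- by rewrite !big_seq1 bZ.
Qed.

Lemma tens_lift_is_zmod_morphism : zmod_morphism (tens_lift_fun bal_b).
Proof.
have liftD z w : tens_lift_fun bal_b (z + w)
    = tens_lift_fun bal_b z + tens_lift_fun bal_b w.
  rewrite -[z]tens_reprK -[w]tens_reprK -tens_classD !tens_lift_class.
  by rewrite big_cat.
by move=> z w; apply: (addIr (tens_lift_fun bal_b w)); rewrite -liftD !subrK.
Qed.

HB.instance Definition _ := GRing.isZmodMorphism.Build
  (tens X F) Z (tens_lift_fun bal_b) tens_lift_is_zmod_morphism.

Definition tens_lift : {additive tens X F -> Z} := tens_lift_fun bal_b.

Lemma tens_liftE x m : tens_lift (tmul x m) = b x m.
Proof. by rewrite /= tens_lift_class big_seq1. Qed.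

End Lift.
End TensorTheory.

Section TensMap.
Variables (A : pzRingType) (X Y : lmodType A^c) (F G : lmodType A).

Lemma tens_map_is_zmod_morphism (g : {linear X -> Y}) :
  zmod_morphism (@tens_map A X Y F g).
Proof.
by move=> z w; apply: (addIr (tens_map g w)); rewrite -tens_mapD !subrK.
Qed.

HB.instance Definition _ (g : {linear X -> Y}) := GRing.isZmodMorphism.Build
  (tens X F) (tens Y F) (@tens_map A X Y F g) (tens_map_is_zmod_morphism g).

Lemma tens_mapE (g : {linear X -> Y}) x (m : F) :
  tens_map g (tmul x m) = tmul (g x) m.
Proof. by rewrite tens_map_class. Qed.

Lemma balanced_mapr (g : {linear F -> G}) :
  balanced (fun (x : X) m => tmul x (g m)).
Proof.
split=> [x y m|x m m'|a x m]; first exact: tmulDl.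
  by rewrite raddfD tmulDr.
by rewrite linearZ tmulZ.
Qed.

Definition tens_mapr (g : {linear F -> G}) : {additive tens X F -> tens X G} :=
  tens_lift (balanced_mapr g).

Lemma tens_maprE (g : {linear F -> G}) x m :
  tens_mapr g (tmul x m) = tmul x (g m).
Proof. exact: tens_liftE. Qed.
End TensMap.

(** * Induction and restriction along a ring morphism *)

Section Induced.
Variables (S A : pzRingType) (f : {rmorphism S -> A}).

Definition imod (M : lmodType S) : lmodType A := ind f M.
Definition rmod (N : lmodType A) : lmodType S := restr f N.

Section IndMul.
Variable M : lmodType S.

Definition imul (a : A) (m : M) : imod M := @tmul S (ring_right f) M a m.

Lemma imulDr a m m' : imul a (m + m') = imul a m + imul a m'.
Proof. exact: (@tmulDr S (ring_right f)). Qed.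

Lemma imulZ a s m : imul (a * f s) m = imul a (s *: m).
Proof. exact: (@tmulZ S (ring_right f) M s a m). Qed.

Lemma imul_suml (I : Type) (r : seq I) (a : I -> A) m :
  imul (\sum_(i <- r) a i) m = \sum_(i <- r) imul (a i) m.
Proof. exact: (@tmul_suml S (ring_right f)). Qed.

Lemma imul_sumr (I : Type) (r : seq I) a (m : I -> M) :
  imul a (\sum_(i <- r) m i) = \sum_(i <- r) imul a (m i).
Proof. exact: (@tmul_sumr S (ring_right f)). Qed.

Lemma scale_imul a b m : a *: imul b m = imul (a * b) m.
Proof.
exact: (@tens_mapE S (ring_right f) (ring_right f) M (@lmulmap S A f a) b m).
Qed.

Lemma ind_ind (P : imod M -> Prop) :
  P 0 -> (forall a m, P (imul a m)) ->
  (forall z w, P z -> P w -> P (z + w)) -> forall z, P z.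
Proof. exact: (@tens_ind S (ring_right f) M). Qed.

Definition iunit_fun (m : M) : rmod (imod M) := imul 1 m.

Lemma iunit_is_linear : linear iunit_fun.
Proof.
move=> s m m'; rewrite /iunit_fun imulDr -imulZ mul1r.
by rewrite -[f s in LHS]mulr1 -scale_imul.
Qed.

Definition iunit : {linear M -> rmod (imod M)} := linear_of iunit_is_linear.

Section Desc.
Variables (N : lmodType A) (g : {linear M -> rmod N}).

Lemma idesc_balanced :
  balanced (fun (a : ring_right f) (m : M) => (a : A) *: (g m : N)).
Proof.
split=> [a b m|a m m'|s a m]; first exact: scalerDl.
  by rewrite raddfD; apply: scalerDr.
by rewrite linearZ [RHS]scalerA.
Qed.

Definition idesc_fun : {additive imod M -> N} := tens_lift idesc_balanced.

Lemma idesc_funE a m : idesc_fun (imul a m) = a *: (g m : N).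
Proof. exact: tens_liftE. Qed.

Lemma idesc_is_linear : linear idesc_fun.
Proof.
move=> a z w; rewrite raddfD; congr (_ + _).
elim/ind_ind: z => [|b m|z z' Ez Ez']; first by rewrite scaler0 raddf0 scaler0.
  by rewrite scale_imul !idesc_funE scalerA.
by rewrite scalerDr !raddfD Ez Ez'.
Qed.

(** Adjoint transpose of [g]; with [iunit] as unit, induction is left adjoint to restriction. *)
Definition idesc : {linear imod M -> N} := linear_of idesc_is_linear.

Lemma idescE a m : idesc (imul a m) = a *: (g m : N).
Proof. exact: idesc_funE. Qed.

End Desc.

(** Uniqueness of transposes: the tensors 1 (x) m generate the induced module over A. *)
Lemma eq_ind_lin (N : lmodType A) (u v : {linear imod M -> N}) :
  (forall m, u (imul 1 m) = v (imul 1 m)) -> u =1 v.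
Proof.
move=> uv z; elim/ind_ind: z => [|a m|z w Ez Ew]; first by rewrite !raddf0.
  by rewrite -[a]mulr1 -scale_imul !linearZ uv.
by rewrite !linearD Ez Ew.
Qed.

End IndMul.

Lemma restr_linearZ (N : lmodType A) (M : lmodType S)
  (g : {linear rmod N -> M}) s (x : N) : g (f s *: x) = s *: g x.
Proof. exact: (@linearZZ _ _ _ g s x). Qed.

(** Kept transparent, so that it computes to [g] and surjectivity or exactness over A is convertible
    to the same fact over S. *)
Definition restr_map (U V : lmodType A) (g : {linear U -> V}) :
    {linear rmod U -> rmod V}.
Proof.
apply: (@linear_of S (rmod U) (rmod V) (g : U -> V)) => s x y.
exact: (linearP g).
Defined.

Definition imap (M M' : lmodType S) (g : {linear M -> M'}) :
  {linear imod M -> imod M'} := idesc (iunit M' \o g).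

Lemma imapE (M M' : lmodType S) (g : {linear M -> M'}) a m :
  imap g (imul a m) = imul a (g m).
Proof. by rewrite idescE /= /iunit_fun scale_imul mulr1. Qed.

Definition restr_seq (F : lmodType A) (P : augmented_seq F) :
    augmented_seq (rmod F) :=
  @AugmentedSeq S (rmod F) (fun i => rmod (P i))
    (fun i => restr_map (diff P i)) (restr_map (aug P)).

Definition ind_seq (F : lmodType S) (P : augmented_seq F) :
    augmented_seq (imod F) :=
  @AugmentedSeq A (imod F) (fun i => imod (P i))
    (fun i => imap (diff P i)) (imap (aug P)).

(** A left adjoint of a functor preserving surjections preserves projectives: lift the transposed
    problem over S, then transpose back. *)
Lemma ind_projective (P : lmodType S) : projective P -> projective (imod P).
Proof.
move=> projP U V p g p_surj.
have [h ph] := projP (rmod U) (rmod V) (restr_map p)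
  (restr_map g \o iunit P) p_surj.
exists (idesc h); apply: (@eq_ind_lin _ _ (p \o idesc h) g) => m /=.
by rewrite [idesc_fun _ _]idesc_funE scale1r; apply: ph.
Qed.

Lemma ind_fingen (P : lmodType S) : fingen P -> fingen (imod P).
Proof.
move=> [r [e gen_e]]; exists r, (fun i => imul 1 (e i)) => z.
elim/ind_ind: z => [|a m|z w [c ->] [d ->]].
- by exists (fun=> 0); rewrite big1 // => i _; rewrite scale0r.
- have [c ->] := gen_e m; exists (fun i => a * f (c i)).
  rewrite imul_sumr; apply: eq_bigr => i _.
  by rewrite scale_imul mulr1 imulZ.
- exists (fun i => c i + d i); rewrite -big_split /=.
  by apply: eq_bigr => i _; rewrite scalerDl.
Qed.

Lemma imap_surj (M M' : lmodType S) (g : {linear M -> M'}) :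
  (forall y, exists x, g x = y) -> forall z, exists w, imap g w = z.
Proof.
move=> g_surj z; elim/ind_ind: z => [|a m|z w [z' <-] [w' <-]].
- by exists 0; rewrite raddf0.
- by have [x <-] := g_surj m; exists (imul a x); rewrite imapE.
- by exists (z' + w'); rewrite raddfD.
Qed.

End Induced.

(** * Split Frobenius extensions *)

(* A Frobenius extension whose Frobenius homomorphism exp retracts f; the     *)
(* dual bases are frob_l and frob_r.                                          *)
Record frobenius (S A : pzRingType) (f : {rmorphism S -> A}) := Frobenius {
  frob_index : finType;
  frob_l : frob_index -> A;
  frob_r : frob_index -> A;
  frob_exp : {additive A -> S};
  frob_expZl : forall s a, frob_exp (f s * a) = s * frob_exp a;
  frob_expZr : forall s a, frob_exp (a * f s) = frob_exp a * s;
  frob_exp1 : frob_exp 1 = 1;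
  frob_sum_l : forall a, \sum_i frob_l i * f (frob_exp (frob_r i * a)) = a;
  frob_sum_r : forall a, \sum_i f (frob_exp (a * frob_l i)) * frob_r i = a
}.

Arguments frob_l {S A f} Phi i : rename.
Arguments frob_r {S A f} Phi i : rename.
Arguments frob_exp {S A f} Phi : rename.
Arguments frob_expZl {S A f} Phi s a : rename.
Arguments frob_expZr {S A f} Phi s a : rename.
Arguments frob_exp1 {S A f} Phi : rename.
Arguments frob_sum_l {S A f} Phi a : rename.
Arguments frob_sum_r {S A f} Phi a : rename.

(** Reversing multiplication swaps the two dual bases and the two linearity laws of the Frobenius
    homomorphism. *)
Definition frobenius_conv (S A : pzRingType) (f : {rmorphism S -> A})
  (Phi : frobenius f) : frobenius (conv_rmor f) :=
  @Frobenius S^c A^c (conv_rmor f) (frob_index Phi) (frob_r Phi) (frob_l Phi)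
    (frob_exp Phi) (frob_expZr Phi) (frob_expZl Phi) (frob_exp1 Phi)
    (frob_sum_r Phi) (frob_sum_l Phi).

Section FrobeniusExtension.
Variables (S A : pzRingType) (f : {rmorphism S -> A}) (Phi : frobenius f).
Local Notation E := (frob_exp Phi).
Local Notation l := (frob_l Phi).
Local Notation r := (frob_r Phi).

Section Counit.
Variable M : lmodType S.

Lemma icounit_balanced :
  balanced (fun (a : ring_right f) (m : M) => E a *: m).
Proof.
split=> [a b m|a m m'|s a m]; first by rewrite raddfD scalerDl.
  by rewrite scalerDr.
by rewrite scalerA -frob_expZr.
Qed.

Definition icounit_fun : {additive imod f M -> M} := tens_lift icounit_balanced.

Lemma icounit_funE a m : icounit_fun (imul f a m) = E a *: m.
Proof. exact: tens_liftE. Qed.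

Lemma icounit_is_linear : linear (icounit_fun : rmod f (imod f M) -> M).
Proof.
move=> s z w; rewrite [LHS](raddfD icounit_fun (f s *: (z : imod f M))).
congr (_ + _); move: z; apply: ind_ind => [|a m|z z' Ez Ez'].
- by rewrite scaler0 raddf0 scaler0.
- by rewrite scale_imul !icounit_funE frob_expZl scalerA.
- by rewrite scalerDr !raddfD Ez Ez'.
Qed.

(** Counit of the second adjunction, in which induction is right adjoint to restriction. *)
Definition icounit : {linear rmod f (imod f M) -> M} :=
  linear_of icounit_is_linear.

Lemma icounitE a m : icounit (imul f a m) = E a *: m.
Proof. exact: icounit_funE. Qed.

Lemma iunitK m : icounit (iunit f M m) = m.
Proof. by rewrite icounitE frob_exp1 scale1r. Qed.

(** Identifies M^ with the coinduced module Hom_S(A, M): z is rebuilt from the values of a |->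
    [icounit (a *: z)] at the [r i]. *)
Lemma ind_decomp (z : imod f M) :
  z = \sum_i imul f (l i) (icounit (r i *: z)).
Proof.
elim/ind_ind: z => [|a m|z w Ez Ew].
- rewrite big1 // => i _; rewrite scaler0 raddf0.
  exact: (@tmul0r S (ring_right f)).
- under eq_bigr => i _ do rewrite scale_imul icounitE -imulZ.
  by rewrite -imul_suml frob_sum_l.
- rewrite {1}Ez {1}Ew -big_split /=; apply: eq_bigr => i _.
  by rewrite -imulDr scalerDr raddfD.
Qed.

Section Coind.
Variables (N : lmodType A) (g : {linear rmod f N -> M}).

(** Transpose of [g] for the second adjunction; seen in Hom_S(A, M), it sends x to a |-> g (a x). *)
Definition coind_fun (x : N) : imod f M := \sum_i imul f (l i) (g (r i *: x)).

Lemma coind_is_linear : linear coind_fun.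
Proof.
move=> a x y; rewrite /coind_fun scaler_sumr.
under eq_bigr => i _ do rewrite scalerDr [g _]raddfD imulDr.
rewrite big_split /=; congr (_ + _).
(* Expand [r i * a] over the [r j] and move the coefficients across the tensor sign; [frob_sum_l]
   then resums over i to [a * l j]. *)
transitivity (\sum_i \sum_j imul f (l i * f (E (r i * (a * l j))))
                                   (g (r j *: x))).
  apply: eq_bigr => i _; rewrite scalerA.
  rewrite -{1}[r i * a](frob_sum_r Phi) scaler_suml raddf_sum imul_sumr.
  apply: eq_bigr => j _; rewrite imulZ -scalerA mulrA.
  exact/congr1/(restr_linearZ g).
rewrite exchange_big /=; apply: eq_bigr => j _.
by rewrite -imul_suml frob_sum_l scale_imul.
Qed.

Definition coind : {linear N -> imod f M} := linear_of coind_is_linear.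

Lemma coindK (x : N) : icounit (coind x) = g x.
Proof.
rewrite /= /coind_fun raddf_sum -[x in RHS]scale1r.
rewrite -[1 in RHS](frob_sum_r Phi) scaler_suml [RHS]raddf_sum.
apply: eq_bigr => i _; rewrite icounit_funE mul1r -scalerA.
by apply/esym/(restr_linearZ g).
Qed.

End Coind.

End Counit.

Lemma icounit_nat (M M' : lmodType S) (g : {linear M -> M'}) (z : imod f M) :
  icounit M' (imap f g z) = g (icounit M z).
Proof.
elim/ind_ind: z => [|a m|z w Ez Ew]; first by rewrite !raddf0.
  by rewrite imapE !icounitE linearZ.
by rewrite !linearD Ez Ew.
Qed.

(** By naturality, the components [icounit (r i *: z)] of an element z killed by [imap f h] are
    killed by h; their preimages under g are reassembled with the [l i]. *)
Lemma imap_exact (U V W : lmodType S) (g : {linear U -> V})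
    (h : {linear V -> W}) :
  exact_at g h -> exact_at (imap f g) (imap f h).
Proof.
move=> gh z; split=> [hz|[w <-]]; last first.
  elim/ind_ind: w => [|a m|w w' Ew Ew']; first by rewrite !raddf0.
    rewrite !imapE (_ : h (g m) = 0); last by apply/gh; exists m.
    exact: (@tmul0r S (ring_right f)).
  by rewrite !linearD Ew Ew' addr0.
have /choice[x xP] i : exists x, g x = icounit V (r i *: z).
  by apply/gh; rewrite -icounit_nat linearZZ hz scaler0 raddf0.
exists (\sum_i imul f (l i) (x i)); rewrite linear_sum [RHS]ind_decomp.
by apply: eq_bigr => i _; rewrite imapE xP.
Qed.

(** Dual use of the second adjunction: restriction is left adjoint to induction, which preserves
    surjections. *)
Lemma restr_projective (P : lmodType A) : projective P -> projective (rmod f P).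
Proof.
move=> projP U V p g p_surj.
have [h ph] := projP _ _ (imap f p) (coind g) (imap_surj p_surj).
exists (icounit U \o restr_map f h) => x /=.
by rewrite -[RHS]coindK -ph icounit_nat.
Qed.

Lemma fingen_fin (B : pzRingType) (P : lmodType B) (I : finType) (e : I -> P) :
  (forall x, exists c : I -> B, x = \sum_i c i *: e i) -> fingen P.
Proof.
move=> gen_e; exists #|I|, (fun i => e (enum_val i)) => x.
have [c ->] := gen_e x; exists (fun i => c (enum_val i)).
by rewrite (reindex (@enum_val I I)) //=; apply/onW_bij/enum_val_bij.
Qed.

(** The [r j] generate A as a left S-module, so the products [r j *: e i] generate P over S. *)
Lemma restr_fingen (P : lmodType A) : fingen P -> fingen (rmod f P).
Proof.
move=> [q [e gen_e]].
apply: (@fingen_fin S (rmod f P) ('I_q * frob_index Phi)%type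
          (fun p => r p.2 *: e p.1)) => x.
have [c ->] := gen_e x; exists (fun p => E (c p.1 * l p.2)).
rewrite -(pair_bigA _ (fun i j => E (c i * l j) *: (r j *: e i : rmod f P))) /=.
apply: eq_bigr => i _; rewrite -{1}[c i](frob_sum_r Phi) scaler_suml.
by apply: eq_bigr => j _; rewrite -scalerA.
Qed.

Lemma ind_resolution (F : lmodType S) (P : augmented_seq F) :
  proj_resolution P -> proj_resolution (ind_seq f P).
Proof.
move=> [projP augP ex0 exP]; split=> /=.
- by move=> i; apply/ind_projective/projP.
- exact: imap_surj.
- exact: imap_exact.
- by move=> i; apply: imap_exact.
Qed.

Lemma restr_resolution (F : lmodType A) (P : augmented_seq F) :
  proj_resolution P -> proj_resolution (restr_seq f P).
Proof.
by move=> [projP augP ex0 exP]; split=> // i; apply/restr_projective/projP.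
Qed.

Lemma ind_fin_presented n (F : lmodType S) :
  fin_presented n F -> fin_presented n (imod f F).
Proof.
move=> [P [fgP augP ex0 exP]]; exists (ind_seq f P); split=> /=.
- by move=> i /fgP[? ?]; split; [apply: ind_fingen | apply: ind_projective].
- exact: imap_surj.
- by move=> /ex0; apply: imap_exact.
- by move=> i /exP; apply: imap_exact.
Qed.

Lemma restr_fin_presented n (F : lmodType A) :
  fin_presented n F -> fin_presented n (rmod f F).
Proof.
move=> [P [fgP augP ex0 exP]]; exists (restr_seq f P); split=> //= i /fgP[? ?].
by split; [apply: restr_fingen | apply: restr_projective].
Qed.


(** * Vanishing of Ext *)

Lemma Ext_retract (B : pzRingType) (F M M' : lmodType B) (u : {linear M -> M'})
    (v : {linear M' -> M}) k :
  cancel u v -> Ext_eq0 k.+1 F M' -> Ext_eq0 k.+1 F M.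
Proof.
move=> uK ext0 P resP c cocycle_c.
have [|b cE] := ext0 P resP (u \o c).
  by move=> x /=; rewrite cocycle_c raddf0.
by exists (v \o b) => x; rewrite -[LHS]uK [u _]cE.
Qed.

(** Induce the resolution of F, transpose the cocycle with [idesc], and transpose the bounding
    cochain back along [iunit]. *)
Lemma Ext_restr (F : lmodType S) (N : lmodType A) k :
  Ext_eq0 k.+1 (imod f F) N -> Ext_eq0 k.+1 F (rmod f N).
Proof.
move=> ext0 P resP c cocycle_c.
have [|b cE] := ext0 _ (ind_resolution resP) (idesc c).
  apply: (eq_ind_lin (u := idesc c \o imap f (diff P k.+1)) (v := \0)) => x.
  transitivity (idesc c (imap f (diff P k.+1) (imul f 1 x))) => //.
  by rewrite imapE idescE cocycle_c scaler0.
exists (restr_map f b \o iunit f (P k)) => x.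
by have := cE (imul f 1 x); rewrite idescE scale1r [diff _ _]/= imapE.
Qed.

(** Restrict the resolution of F and use the second adjunction: [icounit] transposes the cocycle,
    [coind] the bounding cochain. *)
Lemma Ext_ind (F : lmodType A) (M : lmodType S) k :
  Ext_eq0 k.+1 (rmod f F) M -> Ext_eq0 k.+1 F (imod f M).
Proof.
move=> ext0 P resP c cocycle_c.
have [|b cE] := ext0 _ (restr_resolution resP) (icounit M \o restr_map f c).
  by move=> x; apply: etrans (congr1 (icounit M) (cocycle_c x)) (raddf0 _).
(* By [ind_decomp] it suffices to compare components, and the i-th one is [cE] at [r i *: x]. *)
exists (coind b) => x; rewrite [LHS]ind_decomp; apply: eq_bigr => i _.
rewrite -linearZZ; congr (imul f _ _); rewrite -[r i *: _ in RHS]linearZZ.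
exact: cE.
Qed.

(** A cochain b bounding c over S is averaged by the separability element into an A-linear one,
    which still bounds c because c and the differential are A-linear and the products of the element
    sum to 1. *)
Lemma Ext_separable (F N : lmodType A) k :
  separable_extension f ->
  Ext_eq0 k.+1 (rmod f F) (rmod f N) -> Ext_eq0 k.+1 F N.
Proof.
move=> [s [s_central s1]] ext0 P resP c cocycle_c.
have [b cE] := ext0 _ (restr_resolution resP) (restr_map f c) cocycle_c.
pose b' (x : P k) : N := \sum_(p <- s) p.1 *: (b (p.2 *: x) : N).
(* Centrality is an identity in A (x)_S A; S-linearity of b allows it to be evaluated through p (x)
   q |-> p b(q x). *)
have bal_b x : @balanced S (ring_right f) (restr f A^o) N
    (fun p q : A => p *: (b (q *: x) : N)).
  split=> [p q m|p m m'|t p q]; first exact: scalerDl.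
    by rewrite scalerDl raddfD; apply: scalerDr.
  rewrite -[LHS]scalerA; congr (_ *: _).
  by apply: etrans (esym (restr_linearZ b t (q *: x))) _; rewrite scalerA.
have lin_b : linear b'.
  move=> a x y; rewrite /b'.
  transitivity (\sum_(p <- s) p.1 *: (b ((p.2 * a) *: x) : N)
                + \sum_(p <- s) p.1 *: (b (p.2 *: y) : N)).
    rewrite -big_split; apply: eq_bigr => p _ /=.
    by rewrite scalerDr scalerA [b _]raddfD; apply: scalerDr.
  congr (_ + _); have := congr1 (tens_lift (bal_b x)) (s_central a).
  rewrite [LHS]tens_lift_class [RHS]tens_lift_class !big_map /= => ->.
  by rewrite scaler_sumr; apply: eq_bigr => p _; rewrite scalerA.
exists (linear_of lin_b) => x.
rewrite -[LHS]scale1r -s1 scaler_suml; apply: eq_bigr => p _.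
rewrite -scalerA -linearZZ; congr (_ *: _).
by rewrite -linearZZ; apply: cE.
Qed.

End FrobeniusExtension.

(** * Vanishing of Tor *)

(** A split injection u of complexes, with retraction v, reflects acyclicity: if w bounds u z then v
    w bounds z. The rings may differ, and the hypotheses are only asked on pure tensors, which
    generate. *)
Lemma boundary_retract (A B : pzRingType) (X : lmodType A^c) (F : lmodType A)
    (Y : lmodType B^c) (G : lmodType B) (P : augmented_seq X)
    (Q : augmented_seq Y)
    (u : forall i, {additive tens (P i) F -> tens (Q i) G})
    (v : forall i, {additive tens (Q i) G -> tens (P i) F}) k :
  (forall i x m, tens_map (diff Q i) (u i.+1 (tmul x m)) =
                 u i (tmul (diff P i x) m)) ->
  (forall i y m, v i (tmul (diff Q i y) m) =
                 tens_map (diff P i) (v i.+1 (tmul y m))) ->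
  (forall i x m, v i (u i (tmul x m)) = tmul x m) ->
  (forall w : tens (Q k.+1) G, Defs.cycle w -> boundary w) ->
  forall z : tens (P k.+1) F, Defs.cycle z -> boundary z.
Proof.
move=> u_nat v_nat uK bQ z dz.
have uN i w : tens_map (diff Q i) (u i.+1 w) = u i (tens_map (diff P i) w).
  apply: (eq_tens (u := tens_map (diff Q i) \o u i.+1)
    (v := u i \o tens_map (diff P i))) => x m.
  by rewrite [LHS]u_nat /= tens_mapE.
have vN i w : v i (tens_map (diff Q i) w) = tens_map (diff P i) (v i.+1 w).
  apply: (eq_tens (u := v i \o tens_map (diff Q i))
    (v := tens_map (diff P i) \o v i.+1)) => y m.
  by rewrite -[RHS]v_nat /= tens_mapE.
have [|w dw] := bQ (u k.+1 z); first by rewrite /= uN [tens_map _ z]dz raddf0.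
exists (v k.+2 w); rewrite -vN dw.
by apply: (eq_tens (u := v k.+1 \o u k.+1) (v := idfun)) => x m; apply: uK.
Qed.

Lemma Tor_retract (B : pzRingType) (X : lmodType B^c) (F G : lmodType B)
    (u : {linear F -> G}) (v : {linear G -> F}) k :
  cancel u v -> Tor_eq0 k.+1 X G -> Tor_eq0 k.+1 X F.
Proof.
move=> uK tor0 P resP.
apply: (boundary_retract (u := fun i => tens_mapr (P i) u)
  (v := fun i => tens_mapr (P i) v)) (tor0 P resP) => i x m.
- by rewrite !tens_maprE tens_mapE.
- by rewrite !tens_maprE tens_mapE.
- by rewrite !tens_maprE uK.
Qed.

(** * Change of rings in tensor products *)

Section RestrictedTensor.
Variables (S A : pzRingType) (f : {rmorphism S -> A}).
Local Notation fc := (conv_rmor f).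

Section RightInduced.
Variables (X : lmodType S^c) (N : lmodType A).

Lemma tens_ind_r_balanced :
  balanced (fun (x : X) (m : rmod f N) =>
    tmul (iunit fc X x : imod fc X) (m : N)).
Proof.
split=> [x y m|x m m'|s x m]; first by rewrite raddfD; apply: tmulDl.
  exact: tmulDr.
by rewrite linearZ; apply: tmulZ.
Qed.

(** One direction of the isomorphism of X (x)_S N| with (X (x)_S A) (x)_A N; [ind_r_tens] is the
    other. *)
Definition tens_ind_r : {additive tens X (rmod f N) -> tens (imod fc X) N} :=
  tens_lift tens_ind_r_balanced.

Lemma tens_ind_rE x m : tens_ind_r (tmul x m) = tmul (imul fc 1 x) m.
Proof. exact: tens_liftE. Qed.

(** The source of [ind_r_tens] is an iterated tensor product: lift over the inner one with m fixed,
    then over the outer one. *)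
Lemma ind_r_tens_balanced1 (m : N) :
  @balanced S^c (ring_right fc) X (tens X (rmod f N))
    (fun a x => tmul x ((a : A) *: m : rmod f N)).
Proof.
split=> [a b x|a x y|s a x].
- by rewrite scalerDl; apply: tmulDr.
- exact: tmulDl.
- by rewrite tmulZ; congr tmul; apply: esym (scalerA (f s) (a : A) m).
Qed.

Lemma ind_r_tens_balanced :
  balanced (fun (y : imod fc X) m => tens_lift (ind_r_tens_balanced1 m) y).
Proof.
split=> [y y' m|y m m'|a y m]; first exact: raddfD.
  elim/ind_ind: y => [|a x|y y' Ey Ey']; first by rewrite !raddf0 addr0.
    by rewrite !tens_liftE scalerDr; apply: tmulDr.
  by rewrite !raddfD /= Ey Ey' addrACA.
elim/ind_ind: y => [|b x|y y' Ey Ey']; first by rewrite scaler0 !raddf0.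
  by rewrite scale_imul !tens_liftE scalerA.
by rewrite scalerDr !raddfD Ey Ey'.
Qed.

Definition ind_r_tens : {additive tens (imod fc X) N -> tens X (rmod f N)} :=
  tens_lift ind_r_tens_balanced.

Lemma ind_r_tensE a x m :
  ind_r_tens (tmul (imul fc a x) m) = tmul x ((a : A) *: m : rmod f N).
Proof. by rewrite [LHS]tens_liftE; apply: tens_liftE. Qed.

End RightInduced.

Section LeftInduced.
Variables (X : lmodType A^c) (M : lmodType S).

Lemma tens_ind_l_balanced :
  balanced (fun (x : rmod fc X) m => tmul (x : X) (iunit f M m : imod f M)).
Proof.
split=> [x y m|x m m'|s x m]; first exact: tmulDl.
  by rewrite raddfD; apply: tmulDr.
by rewrite linearZ; apply: (@tmulZ _ X (imod f M) (f s)).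
Qed.

(** One direction of the isomorphism of X| (x)_S M with X (x)_A (A (x)_S M); [ind_l_tens] is the
    other. *)
Definition tens_ind_l : {additive tens (rmod fc X) M -> tens X (imod f M)} :=
  tens_lift tens_ind_l_balanced.

Lemma tens_ind_lE x m : tens_ind_l (tmul x m) = tmul (x : X) (imul f 1 m).
Proof. exact: tens_liftE. Qed.

Lemma ind_l_tens_balanced1 (x : X) :
  @balanced S (ring_right f) M (tens (rmod fc X) M)
    (fun a m => tmul ((a : A^c) *: x : rmod fc X) m).
Proof.
split=> [a b m|a m m'|s a m].
- by rewrite scalerDl; apply: tmulDl.
- exact: tmulDr.
- by rewrite -tmulZ; congr tmul; apply: esym (scalerA (f s : A^c) (a : A^c) x).
Qed.

Lemma ind_l_tens_balanced :
  balanced (fun (x : X) (y : imod f M) => tens_lift (ind_l_tens_balanced1 x) y).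
Proof.
split=> [x x' y|x y y'|a x y]; last 1 first.
- elim/ind_ind: y => [|b m|y y' Ey Ey']; first by rewrite scaler0 !raddf0.
    by rewrite scale_imul !tens_liftE scalerA.
  by rewrite scalerDr !raddfD Ey Ey'.
- elim/ind_ind: y => [|b m|y y' Ey Ey']; first by rewrite !raddf0 addr0.
    by rewrite !tens_liftE scalerDr; apply: tmulDl.
  by rewrite !raddfD /= Ey Ey' addrACA.
- exact: raddfD.
Qed.

Definition ind_l_tens : {additive tens X (imod f M) -> tens (rmod fc X) M} :=
  tens_lift ind_l_tens_balanced.

Lemma ind_l_tensE x a m :
  ind_l_tens (tmul x (imul f a m)) = tmul ((a : A^c) *: x : rmod fc X) m.
Proof. by rewrite [LHS]tens_liftE; apply: tens_liftE. Qed.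

End LeftInduced.

Section Separable.
Variables (X : lmodType A^c) (N : lmodType A).

Lemma tens_unrestr_balanced :
  balanced (fun (x : rmod fc X) (m : rmod f N) => tmul (x : X) (m : N)).
Proof.
split=> [x y m|x m m'|s x m]; [exact: tmulDl | exact: tmulDr |].
exact: (@tmulZ _ X N (f s)).
Qed.

Definition tens_unrestr : {additive tens (rmod fc X) (rmod f N) -> tens X N} :=
  tens_lift tens_unrestr_balanced.

Lemma tens_unrestrE x m : tens_unrestr (tmul x m) = tmul (x : X) (m : N).
Proof. exact: tens_liftE. Qed.

(** Lets identities of A (x)_S A be evaluated at a pair (x, m), as p (x) q |-> xp (x) qm. *)
Lemma tens_act_balanced (x : X) (m : N) :
  @balanced S (ring_right f) (restr f A^o) (tens (rmod fc X) (rmod f N))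
    (fun p q : A => tmul ((p : A^c) *: x : rmod fc X) (q *: m : rmod f N)).
Proof.
split=> [p q a|a p q|s p q].
- by rewrite scalerDl; apply: tmulDl.
- by rewrite scalerDl; apply: tmulDr.
- transitivity (tmul ((s : S^c) *: ((p : A^c) *: x : rmod fc X))
                     ((q : A) *: m : rmod f N)).
    by congr tmul; apply: esym (scalerA (f s : A^c) (p : A^c) x).
  by rewrite tmulZ; congr tmul; apply: (scalerA (f s) (q : A) m).
Qed.

Variable s : seq (A * A).
Hypothesis s_central : forall a : A,
  @tens_class S (ring_right f) (restr f A^o) [seq (p.1, p.2 * a) | p <- s] =
  @tens_class S (ring_right f) (restr f A^o) [seq (a * p.1, p.2) | p <- s].

(** Centrality of the separability element gives A-balancedness; the resulting map is a section of
    the canonical map X| (x)_S N| -> X (x)_A N once the products sum to 1. *)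
Lemma tens_spread_balanced :
  balanced (fun (x : X) (m : N) => \sum_(p <- s)
    tmul ((p.1 : A^c) *: x : rmod fc X) (p.2 *: m : rmod f N)).
Proof.
split=> [x y m|x m m'|a x m].
- rewrite -big_split; apply: eq_bigr => p _ /=.
  by rewrite scalerDr; apply: tmulDl.
- rewrite -big_split; apply: eq_bigr => p _ /=.
  by rewrite scalerDr; apply: tmulDr.
- have := congr1 (tens_lift (tens_act_balanced x m)) (s_central a).
  rewrite [LHS]tens_lift_class [RHS]tens_lift_class !big_map /= => E.
  transitivity (\sum_(p <- s) tmul ((a * p.1 : A^c) *: x : rmod fc X)
                                   (p.2 *: m : rmod f N)).
    by apply: eq_bigr => p _; rewrite scalerA.
  by rewrite -[LHS]E; apply: eq_bigr => p _; rewrite scalerA.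
Qed.

Definition tens_spread : {additive tens X N -> tens (rmod fc X) (rmod f N)} :=
  tens_lift tens_spread_balanced.

Lemma tens_spreadE x m : tens_spread (tmul x m) = \sum_(p <- s)
  tmul ((p.1 : A^c) *: x : rmod fc X) (p.2 *: m : rmod f N).
Proof. exact: tens_liftE. Qed.

End Separable.

Variable Phi : frobenius f.

Lemma Tor_restr (X : lmodType S^c) (N : lmodType A) k :
  Tor_eq0 k.+1 (imod fc X) N -> Tor_eq0 k.+1 X (rmod f N).
Proof.
move=> tor0 P resP.
apply: (boundary_retract (Q := ind_seq fc P) (u := fun i => tens_ind_r (P i) N)
  (v := fun i => ind_r_tens (P i) N))
  (tor0 _ (ind_resolution (frobenius_conv Phi) resP)) => i x m.
- by rewrite !tens_ind_rE tens_mapE imapE.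
- elim/ind_ind: x => [|a x|x y Ex Ey].
  + by rewrite linear0 !tmul0l !raddf0.
  + by rewrite imapE !ind_r_tensE tens_mapE.
  + by rewrite linearD !tmulDl !raddfD /= Ex Ey.
- by rewrite tens_ind_rE ind_r_tensE scale1r.
Qed.

Lemma Tor_ind (X : lmodType A^c) (M : lmodType S) k :
  Tor_eq0 k.+1 (rmod fc X) M -> Tor_eq0 k.+1 X (imod f M).
Proof.
move=> tor0 P resP.
apply: (boundary_retract (Q := restr_seq fc P)
  (u := fun i => ind_l_tens (P i) M)
  (v := fun i => tens_ind_l (P i) M))
  (tor0 _ (restr_resolution (frobenius_conv Phi) resP)) => i x m.
- elim/ind_ind: m => [|a m|m m' Em Em'].
  + by rewrite !tmul0r !raddf0.
  + rewrite !ind_l_tensE tens_mapE; congr tmul.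
    exact: (linearZZ (diff P i) (a : A^c) x).
  + by rewrite !tmulDr !raddfD /= Em Em'.
- by rewrite !tens_ind_lE tens_mapE.
- elim/ind_ind: m => [|a m|m m' Em Em'].
  + by rewrite !tmul0r !raddf0.
  + by rewrite ind_l_tensE tens_ind_lE tmulZ scale_imul mulr1.
  + by rewrite !tmulDr !raddfD /= Em Em'.
Qed.

Lemma Tor_separable (X : lmodType A^c) (N : lmodType A) k :
  separable_extension f ->
  Tor_eq0 k.+1 (rmod fc X) (rmod f N) -> Tor_eq0 k.+1 X N.
Proof.
move=> [s [s_central s1]] tor0 P resP.
apply: (boundary_retract (Q := restr_seq fc P)
  (u := fun i => tens_spread (P i) N s_central)
  (v := fun i => tens_unrestr (P i) N))
  (tor0 _ (restr_resolution (frobenius_conv Phi) resP)) => i x m.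
- rewrite !tens_spreadE raddf_sum; apply: eq_bigr => p _.
  rewrite [LHS]tens_mapE; congr tmul.
  exact: (linearZZ (diff P i) (p.1 : A^c) x).
- by rewrite !tens_unrestrE tens_mapE.
- rewrite tens_spreadE raddf_sum.
  under eq_bigr => p _ do rewrite tens_unrestrE tmulZ scalerA.
  by rewrite -tmul_sumr -scaler_suml s1 scale1r.
Qed.

End RestrictedTensor.

(** * Homological dimensions *)

Section FrobeniusDimensions.
Variables (S A : pzRingType) (f : {rmorphism S -> A}) (Phi : frobenius f).
Variable n : nat.

Lemma ind_n0_flat (F : lmodType S) : n0_flat n F -> n0_flat n (imod f F).
Proof.
move=> flatF X fpX; apply: (Tor_ind Phi); apply: flatF.
exact: (restr_fin_presented (frobenius_conv Phi)).
Qed.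

Lemma restr_n0_flat (F : lmodType A) : n0_flat n F -> n0_flat n (rmod f F).
Proof.
move=> flatF X fpX; apply: (Tor_restr Phi); apply: flatF.
exact: (ind_fin_presented (frobenius_conv Phi)).
Qed.

(** The test class [C] is a parameter so that one argument serves both [n0_id] and [nCd]. *)
Definition Ext_vanish (B : pzRingType) (C : lmodType B -> Prop) (M : lmodType B)
  k := forall F, C F -> Ext_eq0 k.+1 F M.

Definition Tor_vanish (B : pzRingType) (C : lmodType B^c -> Prop)
  (M : lmodType B) k := forall F, C F -> Tor_eq0 k.+1 F M.

Section ExtVanish.
Variables (CS : lmodType S -> Prop) (CA : lmodType A -> Prop).
Hypothesis ind_C : forall F, CS F -> CA (imod f F).
Hypothesis restr_C : forall F, CA F -> CS (rmod f F).

Lemma Ext_vanish_restr (N : lmodType A) k :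
  Ext_vanish CA N k -> Ext_vanish CS (rmod f N) k.
Proof. by move=> extN F /ind_C/extN; apply: Ext_restr. Qed.

Lemma Ext_vanish_separable (N : lmodType A) k : separable_extension f ->
  Ext_vanish CA N k <-> Ext_vanish CS (rmod f N) k.
Proof.
move=> sep; split=> [|extN F /restr_C/extN]; first exact: Ext_vanish_restr.
exact: Ext_separable.
Qed.

(** For the converse, restrict M^ to M^| and pass to the direct summand M. *)
Lemma Ext_vanish_ind (M : lmodType S) k :
  Ext_vanish CS M k <-> Ext_vanish CA (imod f M) k.
Proof.
split=> [extM F /restr_C/extM|/Ext_vanish_restr extM F /extM].
  exact: Ext_ind.
exact: (Ext_retract (iunitK Phi (M := M))).
Qed.

End ExtVanish.

Section TorVanish.
Variables (CS : lmodType S^c -> Prop) (CA : lmodType A^c -> Prop).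
Hypothesis ind_C : forall F, CS F -> CA (imod (conv_rmor f) F).
Hypothesis restr_C : forall F, CA F -> CS (rmod (conv_rmor f) F).

Lemma Tor_vanish_restr (N : lmodType A) k :
  Tor_vanish CA N k -> Tor_vanish CS (rmod f N) k.
Proof. by move=> torN F /ind_C/torN; apply: Tor_restr. Qed.

Lemma Tor_vanish_separable (N : lmodType A) k : separable_extension f ->
  Tor_vanish CA N k <-> Tor_vanish CS (rmod f N) k.
Proof.
move=> sep; split=> [|torN F /restr_C/torN]; first exact: Tor_vanish_restr.
exact: Tor_separable.
Qed.

Lemma Tor_vanish_ind (M : lmodType S) k :
  Tor_vanish CS M k <-> Tor_vanish CA (imod f M) k.
Proof.
split=> [torM F /restr_C/torM|/Tor_vanish_restr torM F /torM].
  exact: Tor_ind.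
exact: Tor_retract (iunitK Phi (M := M)).
Qed.

End TorVanish.
End FrobeniusDimensions.

Lemma eq_smallest (P Q : nat -> Prop) :
  (forall k, P k <-> Q k) -> smallest P = smallest Q.
Proof. by move=> PQ; congr smallest; apply/funext => k; apply/propext. Qed.

Lemma smallest_le (P Q : nat -> Prop) :
  (forall k, P k -> Q k) -> edim_le (smallest Q) (smallest P).
Proof.
move=> PQ; rewrite /smallest; case: pselect => [exQ|nexQ].
  case: pselect => [exP|//] /=; case: ex_minnP => i _ min_i.
  by case: ex_minnP => j /asboolP/PQ/asboolP/min_i.
case: pselect => // exP; case: nexQ; case: exP => k /asboolP/PQ/asboolP Qk.
by exists k.
Qed.

(** * The skew group ring *)

Section SkewFrobenius.
Variables (R : pzRingType) (gT : finGroupType) (act : ring_action R gT).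
Variable H : {group gT}.
Local Notation RG := (skew_group_ring act).
Local Notation RH := (skew_group_ring (restr_action act H)).
Local Notation iota := (skew_inclusion act H).
Implicit Types (u v : RG) (s : RH).

Lemma skew_mulE u v k : (u * v) k = \sum_g u g * act g (v (g^-1 * k)%g).
Proof. by rewrite [LHS]ffunE. Qed.

Lemma iotaE s g : iota s g = if g \in H then s (subg H g) else 0.
Proof. by rewrite [LHS]ffunE. Qed.

Definition sbase (t : gT) : RG := [ffun g => if g == t then 1 else 0].

Lemma sbase_mul t u k : (sbase t * u) k = act t (u (t^-1 * k)%g).
Proof.
rewrite skew_mulE (bigD1 t) //= ffunE eqxx mul1r big1 ?addr0 // => g /negbTE gt.
by rewrite ffunE gt mul0r.
Qed.

Lemma mul_sbase u t k : (u * sbase t) k = u (k * t^-1)%g.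
Proof.
rewrite skew_mulE (bigD1 (k * t^-1)%g) //= ffunE invMg invgK mulgKV eqxx.
rewrite rmorph1 mulr1 big1 ?addr0 // => g /negbTE gt; rewrite ffunE.
case: eqP => [tE|_]; last by rewrite rmorph0 mulr0.
by rewrite -tE invMg invgK mulKVg eqxx in gt.
Qed.

Definition skew_exp (u : RG) : RH := [ffun h => u (sgval h)].

Lemma skew_exp_is_zmod_morphism : zmod_morphism skew_exp.
Proof. by move=> u v; apply/ffunP=> h; rewrite !ffunE. Qed.

HB.instance Definition _ := GRing.isZmodMorphism.Build RG RH skew_exp
  skew_exp_is_zmod_morphism.

Lemma iota_exp u g : iota (skew_exp u) g = if g \in H then u g else 0.
Proof. by rewrite iotaE ffunE; case: ifP => // gH; rewrite subgK. Qed.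

Lemma skew_expZl s u : skew_exp (iota s * u) = s * skew_exp u.
Proof.
apply/ffunP=> h; rewrite [RHS]ffunE ffunE skew_mulE (bigID [in H]) /= addrC.
rewrite big1.
  rewrite add0r (reindex (@sgval _ H)) /=; last first.
    by exists (subg H) => [x _|g gH]; rewrite ?sgvalK ?subgK.
  apply: eq_big => [x|x _]; first by rewrite subgP.
  by rewrite iotaE subgP sgvalK ffunE.
by move=> g /negbTE gNH; rewrite iotaE gNH mul0r.
Qed.

Lemma skew_expZr s u : skew_exp (u * iota s) = skew_exp u * s.
Proof.
apply/ffunP=> h; rewrite [RHS]ffunE ffunE skew_mulE (bigID [in H]) /= addrC.
rewrite big1.
  rewrite add0r (reindex (@sgval _ H)) /=; last first.
    by exists (subg H) => [x _|g gH]; rewrite ?sgvalK ?subgK.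
  apply: eq_big => [x|x _]; first by rewrite subgP.
  rewrite iotaE groupMl ?groupV ?subgP // ffunE; congr (_ * act _ (s _)).
  by apply: subg_inj; rewrite /= subgK // groupM ?groupV ?subgP.
move=> g /negbTE gNH.
by rewrite iotaE groupMr ?subgP // groupV gNH rmorph0 mulr0.
Qed.

Lemma skew_exp1 : skew_exp 1 = 1.
Proof.
by apply/ffunP=> h; rewrite !ffunE -(inj_eq subg_inj).
Qed.

(* Padding with zeros off a transversal of the left cosets of H keeps the     *)
(* index type equal to gT.                                                    *)
Definition skew_l (t : gT) : RG :=
  if t == fingroup.repr (t *: H)%g then sbase t else 0.
Definition skew_r (t : gT) : RG := sbase (t^-1)%g.

(** Exactly one index survives: the chosen representative of the left coset of g. *)
Lemma sum_transversal (V : nmodType) (g : gT) (x : V) :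
  \sum_t (if (t == fingroup.repr (t *: H)%g) && (t^-1 * g \in H)%g
          then x else 0) = x.
Proof.
set t0 := fingroup.repr (g *: H)%g.
have E : (t0 *: H = g *: H)%g.
  by apply/lcoset_eqP; apply: (mem_repr g); apply: lcoset_refl.
rewrite (bigD1 t0) //= E eqxx -mem_lcoset E lcoset_refl big1 ?addr0 // => t tt0.
case: ifP => // /andP[/eqP tE]; rewrite -mem_lcoset => /lcoset_eqP Eg.
by rewrite tE -Eg eqxx in tt0.
Qed.

Lemma skew_sum_l u : \sum_t skew_l t * iota (skew_exp (skew_r t * u)) = u.
Proof.
apply/ffunP=> k; rewrite sum_ffunE -[RHS](sum_transversal k).
apply: eq_bigr => t _; rewrite /skew_l; case: ifP => _ /=; last first.
  by rewrite mul0r ffunE.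
rewrite sbase_mul iota_exp; case: ifP => _; last exact: rmorph0.
by rewrite sbase_mul invgK mulKVg -ractM mulgV ract1.
Qed.

Lemma skew_sum_r u : \sum_t iota (skew_exp (u * skew_l t)) * skew_r t = u.
Proof.
(* The term at t sees the coefficient at k only when kt lies in H, that is when t^-1 k^-1 does;
   hence the inverse. *)
apply/ffunP=> k; rewrite sum_ffunE -[RHS](sum_transversal k^-1%g).
apply: eq_bigr => t _; rewrite mul_sbase invgK iota_exp -invMg groupV /skew_l.
case: (t == _) => /=; first by case: ifP => // _; rewrite mul_sbase mulgK.
by rewrite mulr0 ffunE if_same.
Qed.

Definition skew_frobenius : frobenius iota :=
  @Frobenius RH RG iota gT skew_l skew_r skew_exp skew_expZl skew_expZr
    skew_exp1 skew_sum_l skew_sum_r.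

End SkewFrobenius.

Theorem proposition4p8 (R : pzRingType) (gT : finGroupType)
    (act : ring_action R gT) (H : {group gT}) (n : nat)
    (M : lmodType (skew_group_ring (restr_action act H)))
    (N : lmodType (skew_group_ring act)) :
  n0_id n M = n0_id n (induced M) /\
  (edim_le (n0_id n (restricted H N)) (n0_id n N) /\
   (separable_extension (skew_inclusion act H) ->
    n0_id n N = n0_id n (restricted H N))) /\
  n0_fd n M = n0_fd n (induced M) /\
  (edim_le (n0_fd n (restricted H N)) (n0_fd n N) /\
   (separable_extension (skew_inclusion act H) ->
    n0_fd n N = n0_fd n (restricted H N))) /\
  nCd n M = nCd n (induced M) /\
  (edim_le (nCd n (restricted H N)) (nCd n N) /\
   (separable_extension (skew_inclusion act H) ->
    nCd n N = nCd n (restricted H N))).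
Proof.
pose Phi := skew_frobenius act H; pose Phic := frobenius_conv Phi.
(* Stability of the three test classes; the restriction halves close side conditions below from the
   context. *)
pose fp_ind := @ind_fin_presented _ _ _ Phi n.
pose fp_restr := @restr_fin_presented _ _ _ Phi n.
pose fpc_ind := @ind_fin_presented _ _ _ Phic n.
pose fpc_restr := @restr_fin_presented _ _ _ Phic n.
pose flat_ind := @ind_n0_flat _ _ _ Phi n.
pose flat_restr := @restr_n0_flat _ _ _ Phi n.
split; first by apply: eq_smallest => k; apply: (Ext_vanish_ind Phi fp_ind).
split.
  split=> [|sep]; last first.
    by apply: eq_smallest => k; apply: (Ext_vanish_separable Phi fp_ind).
  by apply: smallest_le => k; apply: (Ext_vanish_restr Phi fp_ind).
split; first by apply: eq_smallest => k; apply: (Tor_vanish_ind Phi fpc_ind).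
split.
  split=> [|sep]; last first.
    by apply: eq_smallest => k; apply: (Tor_vanish_separable Phi fpc_ind).
  by apply: smallest_le => k; apply: (Tor_vanish_restr Phi fpc_ind).
split; first by apply: eq_smallest => k; apply: (Ext_vanish_ind Phi flat_ind).
split=> [|sep]; last first.
  by apply: eq_smallest => k; apply: (Ext_vanish_separable Phi flat_ind).
by apply: smallest_le => k; apply: (Ext_vanish_restr Phi flat_ind).
Qed.
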